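(* Let $g$ be a non-constant rational function of one complex variable. If all critical points of $g$ are real, then $g$ is equivalent to a real rational function; that is, there exists a fractional-linear transformation $\phi$ (with complex coefficients) such that $\phi\circ g$ is a rational function with real coefficients.
   Context: A non-constant rational function is written $g=f_1/f_2$ with $f_1,f_2\in\mathbf{C}[z]$ co-prime. Its critical points are the roots of the Wronski determinant $W(f_1,f_2)=f_1f_2'-f_1'f_2$. Two rational functions $g_1,g_2$ are called equivalent if $g_1=\phi\circ g_2$ for some fractional-linear transformation $\phi$. A rational function is real if it can be written as a ratio of two polynomials with real coefficients. *)

(* Defs.v *)
From HB Require Import structures.
From mathcomp Require Import all_boot all_order all_algebra.
From mathcomp Require Import complex.
From mathcomp Require Import reals.

Set Implicit Arguments.
Unset Strict Implicit.
Unset Printing Implicit Defensive.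

Import Order.TTheory GRing.Theory Num.Theory.
Local Open Scope ring_scope.

Notation ratfun K := {fraction {poly K}}.

Section RationalFunctions.
Variable K : fieldType.
Implicit Types (f : {poly K}) (g h : ratfun K) (a b c d z : K).

Definition cst_ratfun c : ratfun K := tofrac c%:P.

Definition nonconstant g : Prop := forall c, g <> cst_ratfun c.

Definition wronskian f1 f2 : {poly K} := f1 * f2^`() - f1^`() * f2.

(* Coprime representations of g differ by a common nonzero scalar, which
   rescales the Wronskian, so the choice of (f1, f2) is immaterial. The
   condition f2 != 0 is needed because coprimep f1 0 holds when f1 is a
   nonzero constant. *)
Definition critical_point g z : Prop :=
  exists f1 f2,
    [/\ f2 != 0, coprimep f1 f2, g = tofrac f1 / tofrac f2
      & root (wronskian f1 f2) z].

(* The composite phi \o g, for phi(w) = (a w + b) / (c w + d). *)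
Definition mobius_comp a b c d g : ratfun K :=
  (cst_ratfun a * g + cst_ratfun b) / (cst_ratfun c * g + cst_ratfun d).

(* g1 = phi \o g2 for some fractional-linear phi. When a d - b c != 0, the
   denominator condition can only fail if g2 is the constant - d / c; then
   phi \o g2 is the constant infinity, which is not an element of K(z). *)
Definition ratfun_equiv g1 g2 : Prop :=
  exists a b c d,
    [/\ a * d - b * c != 0, cst_ratfun c * g2 + cst_ratfun d != 0
      & g1 = mobius_comp a b c d g2].

End RationalFunctions.

(* The complex numbers are R[i] with R : realType. *)
Definition real_ratfun (R : realType) (h : ratfun R[i]) : Prop :=
  exists p q : {poly R},
    q != 0 /\
    h = tofrac (map_poly (real_complex R) p)
        / tofrac (map_poly (real_complex R) q).

(* Main.v *)
Require Import Defs.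
From mathcomp Require Import all_boot all_order all_algebra.
From mathcomp Require Import complex.
From mathcomp Require Import reals.
From mathcomp Require Import perm ring zify.

(* If f1, f2 are coprime, W = f1 f2' - f1' f2 and Q = f1' f2'' - f1'' f2', then
   span(f1, f2) is the set of polynomial solutions of W y'' - W' y' + Q y = 0.
   When W and Q are real, this span is stable under complex conjugation, so it
   has a real basis and g = f1 / f2 is equivalent to a real function. It remains
   to see that Q is real when the roots z_i of W are.

   Let f in the span have simple roots t_j, none of them a root of W. Then the
   t_j satisfy the Bethe equations
     sum_i 1 / (t_j - z_i) = sum_(m != j) 2 / (t_j - t_m),
   which make the multilinear part of prod_j (sum_i x_i / (t_j - z_i)) an
   eigenvector, with eigenvalue - 2 Q(u) / W(u), of the operator
   sum_(i, k) (P_ik - 1) / ((u - z_i) (u - z_k)) of the Gaudin model, where P_ik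
   exchanges x_i and x_k. For real u and z_i this operator is symmetric, so
   - Q(u) / W(u) is real as soon as the eigenvector is nonzero, which holds when
   there are at least twice as many z_i as t_j. This inequality is reached by
   moving a real root of f to infinity. *)

Set Implicit Arguments.
Unset Strict Implicit.
Unset Printing Implicit Defensive.

Import Order.TTheory GRing.Theory Num.Theory.
Local Open Scope ring_scope.

Lemma rem_cons_neq (T : eqType) (s t : T) (ts : seq T) :
  s \in ts -> t \notin ts ->
  rem s (t :: ts) = t :: rem s ts.
Proof. by move=> si ti /=; case: eqP => // e; rewrite -e (negPf ti) in si. Qed.

(** * The Gaudin operator and Bethe vectors *)

Section Gaudin.
Variables (C : fieldType) (I : finType) (z : I -> C).
Implicit Types (phi : {set I} -> C) (S : {set I}) (t u s : C) (ts : seq C).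

(* A function phi on {set I} stands for the multilinear polynomial with
   coefficient phi S at prod_(i in S) x_i; [up t] is then multiplication by
   sum_i x_i / (t - z i), followed by truncation to the multilinear part. *)
Definition pole t i : C := (t - z i)^-1.
Definition up t phi S : C := \sum_(i in S) pole t i * phi (S :\ i).
(** The Cartan current of the Gaudin model acts as [total t] minus twice [weight t]; this is its
    non-scalar part. *)
Definition weight t phi S : C := (\sum_(i in S) pole t i) * phi S.
Definition gaudin u phi S : C :=
  \sum_i \sum_k pole u i * pole u k * (phi (tperm i k @: S) - phi S).
Definition vacuum S : C := (S == set0)%:R.
Definition bethe ts : {set I} -> C := foldr up vacuum ts.
Definition off_poles t := forall i, t != z i.

Lemma pole_mul t s i : t != s -> off_poles t -> off_poles s ->
  pole t i * pole s i = (pole s i - pole t i) / (t - s).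
Proof.
move=> ts ht hs; rewrite /pole.
by field; rewrite !subr_eq0 ts ht hs.
Qed.

Lemma upC t s phi S : up t (up s phi) S = up s (up t phi) S.
Proof.
rewrite /up.
under eq_bigr => i _ do rewrite big_distrr /=.
under [RHS]eq_bigr => i _ do rewrite big_distrr /=.
rewrite (exchange_big_dep (mem S)) /=; last by move=> i j _ /setD1P[].
apply: eq_bigr => i iS; apply: eq_big => j.
  by rewrite !inE iS andbT andbC eq_sym.
by move=> _; rewrite mulrCA !setDDl setUC.
Qed.

(** Shaped after the right-hand sides of [weight_bethe] and [gaudin_bethe], so that an induction
    hypothesis can be pushed under one more [up]. *)
Lemma up_lin t phi c S (J : Type) (r : seq J) (b : J -> C) psi :
  up t (fun K => c * phi K + \sum_(j <- r) b j * psi j K) S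
  = c * up t phi S + \sum_(j <- r) b j * up t (psi j) S.
Proof.
rewrite /up big_distrr /=.
under [X in _ = _ + X]eq_bigr do rewrite big_distrr /=.
rewrite exchange_big -big_split /=; apply: eq_bigr => i _.
rewrite mulrDr mulrCA; congr (_ + _).
by rewrite big_distrr /=; apply: eq_bigr => j _; rewrite mulrCA.
Qed.

Lemma eq_up t phi psi S : phi =1 psi -> up t phi S = up t psi S.
Proof. by move=> e; apply: eq_bigr => i _; rewrite e. Qed.

(** The weights of S and [S :\ i] differ by the pole at i, whose product with the pole of [up s] is
    split by partial fractions. *)
Lemma weight_up t s phi S : t != s -> off_poles t -> off_poles s ->
  weight t (up s phi) S
  = up s (weight t phi) S + (t - s)^-1 * (up s phi S - up t phi S).
Proof.
move=> ts ht hs; rewrite /weight /up -sumrB !big_distrr -big_split /=.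
apply: eq_bigr => i iS; rewrite (big_setD1 i iS) /=.
have := pole_mul i ts ht hs.
set p := pole t i; set q := pole s i; set x := phi _; set D := \sum_(_ in _) _.
move=> e.
rewrite mulrDl (_ : p * (q * x) = (p * q) * x) ?mulrA // e.
ring.
Qed.

Lemma imset_tperm_out i k S : i \notin S -> k \notin S -> tperm i k @: S = S.
Proof.
move=> iS kS; rewrite -[RHS]imset_id; apply: eq_in_imset => j jS.
by rewrite tpermD //; apply/eqP=> e; rewrite e jS in iS kS.
Qed.

Lemma imset_tperm_swap i k S : i \in S -> k \in S ->
  tperm i k @: (S :\ i) = S :\ k.
Proof.
move=> iS kS; apply/setP=> j.
rewrite -{1}[j](tpermK i k) mem_imset ?inE; last exact: perm_inj.
rewrite (can2_eq (tpermK _ _) (tpermK _ _)) tpermL; case: eqP => //= _.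
by case: tpermP => [->|->|]; rewrite ?iS ?kS.
Qed.

(** G is supported on row l and column l, which contribute equally by symmetry; their common entry
    is zero. *)
Lemma sum_cross (G : I -> I -> C) l :
    (forall i k, G i k = G k i) -> G l l = 0 ->
    (forall i k, i != l -> k != l -> G i k = 0) ->
  \sum_i \sum_k G i k = 2 * \sum_k G l k.
Proof.
move=> Gsym Gll G0; rewrite (bigD1 l) //= mulr_natl mulr2n; congr (_ + _).
rewrite [RHS](bigD1 l) //= Gll add0r; apply: eq_bigr => i il.
rewrite (bigD1 l) //= big1 => [|k kl]; last exact: G0.
by rewrite addr0; apply: Gsym.
Qed.

(** Permuting by [tperm i k] replaces the pole at l by the pole at [tperm i k l], so only
    transpositions that move l contribute to the commutator. The pairs (l, k) and (k, l) account for
    the factor 2. *)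
Lemma gaudin_up u t phi S :
  gaudin u (up t phi) S = up t (gaudin u phi) S
  + 2 * \sum_(l in S) \sum_k pole u l * pole u k * (pole t k - pole t l)
      * phi (tperm l k @: (S :\ l)).
Proof.
have upE i k : up t phi (tperm i k @: S)
  = \sum_(l in S) pole t (tperm i k l) * phi (tperm i k @: (S :\ l)).
  rewrite /up big_imset /=; last by move=> ? ? _ _; apply: perm_inj.
  apply: eq_bigr => l lS; congr (_ * phi _); apply/setP=> j.
  rewrite -[j](tpermK i k) !inE (inj_eq perm_inj).
  by rewrite !mem_imset ?inE //; apply: perm_inj.
rewrite /gaudin {2}/up mulr_sumr -big_split /=.
under eq_bigr => i _ do
  (under eq_bigr => k _ do rewrite upE /up -sumrB big_distrr /=;
  rewrite exchange_big /=).
rewrite exchange_big /=; apply: eq_bigr => l lS.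
have -> : 2 * (\sum_k pole u l * pole u k * (pole t k - pole t l)
                 * phi (tperm l k @: (S :\ l)))
  = \sum_i \sum_k pole u i * pole u k * (pole t (tperm i k l) - pole t l)
                 * phi (tperm i k @: (S :\ l)).
  rewrite [RHS](@sum_cross _ l).
  - by congr (_ * _); apply: eq_bigr => k _; rewrite tpermL.
  - by move=> i k; rewrite tpermC [pole u i * _]mulrC.
  - by rewrite tpermL subrr mulr0 mul0r.
  - by move=> i k il kl; rewrite tpermD // subrr mulr0 mul0r.
rewrite big_distrr -big_split /=; apply: eq_bigr => i _.
rewrite big_distrr -big_split /=; apply: eq_bigr => k _.
ring.
Qed.

(** For k in S, [tperm l k] sends [S :\ l] to [S :\ k], and exchanging l with k costs a sign; for k
    outside S it fixes [S :\ l]. The coefficient is thus the sum outside S minus the sum inside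
    S. *)
Lemma commutator_sum (c : I -> I -> C) phi S : (forall l k, c k l = - c l k) ->
    (forall l, c l l = 0) ->
  \sum_(l in S) \sum_k c l k * phi (tperm l k @: (S :\ l))
  = \sum_(l in S) (\sum_k c l k - 2 * \sum_(k in S :\ l) c l k) * phi (S :\ l).
Proof.
move=> cN c0.
have swap : \sum_(l in S) \sum_(k in S) c l k * phi (tperm l k @: (S :\ l))
    = - \sum_(l in S) \sum_(k in S) c l k * phi (S :\ l).
  rewrite exchange_big -sumrN; apply: eq_bigr => k kS.
  rewrite -sumrN; apply: eq_bigr => l lS.
  by rewrite imset_tperm_swap // cN mulNr.
transitivity (\sum_(l in S) (\sum_(k in S) c l k * phi (tperm l k @: (S :\ l))
    + \sum_(k | k \notin S) c l k * phi (S :\ l))).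
  apply: eq_bigr => l lS; rewrite (bigID (mem S)) /=; congr (_ + _).
  apply: eq_bigr => k kS; rewrite imset_tperm_out ?inE ?eqxx //.
  by rewrite (negPf kS) andbF.
rewrite big_split /= swap -sumrN -big_split /=; apply: eq_bigr => l lS.
rewrite -!big_distrl /= [\sum_i c l i](bigID (mem S)) /=.
rewrite [in LHS](big_setD1 l) //.
rewrite [in RHS](big_setD1 l) //= c0 !add0r.
by rewrite -mulNr -mulrDl; congr (_ * _); ring.
Qed.

Definition total t : C := \sum_i pole t i.

Lemma gaudin_up_off_shell u t phi S : u != t -> off_poles u -> off_poles t ->
  gaudin u (up t phi) S = up t (gaudin u phi) S
  + 2 / (u - t) * (total t * up u phi S - total u * up t phi S
      - 2 * (up u (weight t phi) S - up t (weight u phi) S)).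
Proof.
move=> ut hu ht; rewrite gaudin_up; congr (_ + _).
rewrite -mulrA; congr (_ * _).
(* Each product now has one factor in l and one in k, so that the sums over k become [total] and
   [weight]. *)
have cE l k : pole u l * pole u k * (pole t k - pole t l)
    = (u - t)^-1 * (pole u l * pole t k - pole t l * pole u k).
  have ek := pole_mul k ut hu ht; have el := pole_mul l ut hu ht.
  transitivity (pole u l * (pole u k * pole t k)
    - pole u k * (pole u l * pole t l)); first by ring.
  by rewrite ek el; ring.
rewrite commutator_sum; first last.
- by move=> l; rewrite subrr mulr0.
- by move=> l k; ring.
rewrite /up /weight /total !big_distrr -!sumrB big_distrr -sumrB big_distrr /=.
apply: eq_bigr => l lS.
under eq_bigr do rewrite cE.
under [X in _ - _ * X]eq_bigr do rewrite cE.
rewrite -!big_distrr /= !sumrB -!big_distrr /=.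
ring.
Qed.

(** [weight t] kills the vacuum, so only its commutators with the factors [up s] remain. By
    [weight_up] each gives a multiple of the vector itself and a vector with s replaced by t. *)
Lemma weight_bethe t ts S : off_poles t -> {in ts, forall s, off_poles s} ->
    uniq (t :: ts) ->
  weight t (bethe ts) S = (\sum_(s <- ts) (t - s)^-1) * bethe ts S
    + \sum_(s <- ts) - (t - s)^-1 * bethe (t :: rem s ts) S.
Proof.
elim: ts S => [|s ts IH] S ht hts.
  move=> _; rewrite !big_nil /weight mul0r addr0 /= /vacuum.
  by case: eqP => [->|_]; rewrite ?big_set0 ?mul0r ?mulr0.
rewrite /= !inE negb_or => /and3P[/andP[ts' tts] sts uts].
have hs : off_poles s by apply: hts; rewrite mem_head.
have hts' : {in ts, forall r, off_poles r}.
  by move=> r rts; apply: hts; rewrite inE rts orbT.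
rewrite weight_up //.
rewrite (eq_up _ _ (fun K => IH K ht hts' _)); last by rewrite /= tts uts.
rewrite up_lin !big_cons eqxx.
rewrite [in X in _ = _ + (_ + X)](eq_big_seq
    (fun r => - (t - r)^-1 * up s (bethe (t :: rem r ts)) S)); last first.
  move=> r rts; rewrite [if _ then _ else _](rem_cons_neq rts sts) /=.
  by rewrite upC.
ring.
Qed.

(** For monic f and W with roots ts and z, this is f'' / f - (W' / W) (f' / f) at u, that is - Q / W
    when f solves the differential equation. *)
Definition bethe_value u ts : C :=
  (\sum_(t <- ts) (u - t)^-1) ^+ 2 - \sum_(t <- ts) (u - t)^-1 ^+ 2
  - total u * \sum_(t <- ts) (u - t)^-1.

Definition bethe_defect ts s : C :=
  total s - \sum_(m <- rem s ts) 2 / (s - m).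

(* Off-shell Bethe vector equation: the unwanted terms carry the defects of the
   Bethe equations as coefficients. *)
Lemma gaudin_bethe u ts S : off_poles u -> {in ts, forall s, off_poles s} ->
    uniq (u :: ts) ->
  gaudin u (bethe ts) S = 2 * bethe_value u ts * bethe ts S
    + \sum_(s <- ts) 2 * bethe_defect ts s / (u - s) * bethe (u :: rem s ts) S.
Proof.
elim: ts S => [|t ts IH] S hu hts.
  move=> _; rewrite /bethe_value !big_nil !expr2 !mulr0 !subr0.
  rewrite mulr0 mul0r addr0.
  rewrite /gaudin big1 // => i _; rewrite big1 // => k _ /=.
  by rewrite /vacuum imset_eq0 subrr mulr0.
rewrite /= !inE negb_or => /and3P[/andP[ut uts] tts uniqts].
have ht : off_poles t by apply: hts; rewrite mem_head.
have hts' : {in ts, forall r, off_poles r}.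
  by move=> r rts; apply: hts; rewrite inE rts orbT.
rewrite gaudin_up_off_shell //.
rewrite (eq_up _ _ (fun K => IH K hu hts' _)); last by rewrite /= uts uniqts.
rewrite (eq_up _ _ (fun K => weight_bethe K ht hts' _)); last first.
  by rewrite /= tts uniqts.
rewrite (eq_up _ _ (fun K => weight_bethe K hu hts' _)); last first.
  by rewrite /= uts uniqts.
rewrite !up_lin big_cons /= eqxx.
pose X s := up u (up t (bethe (rem s ts))) S.
rewrite -[up u _ S]/(up u (bethe ts) S).
have XE (c : C -> C) : \sum_(s <- ts) c s * up t (bethe (u :: rem s ts)) S
    = \sum_(s <- ts) c s * X s by apply: eq_bigr => s _; rewrite /= upC.
rewrite !XE.
rewrite -[\sum_(i <- ts) - (t - i)^-1 * _]/(\sum_(i <- ts) - (t - i)^-1 * X i).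
(* Adjoining t adds 2 / (s - t) to the sum in the defect at s; partial fractions split this
   contribution into the terms produced by [weight_bethe] at t and at u. *)
rewrite [in RHS](eq_big_seq (fun s => 2 * bethe_defect ts s / (u - s) * X s
   + 2 / (u - t) * (- 2) * (- (t - s)^-1 * X s - - (u - s)^-1 * X s)));
  last first.
  move=> s sts; rewrite [if _ then _ else _](rem_cons_neq sts tts) /=.
  rewrite -/(X s) /bethe_defect (rem_cons_neq sts tts) big_cons.
  have st : t != s by apply: contraNneq tts => ->.
  have us : u != s by apply: contraNneq uts => ->.
  by field; rewrite !subr_eq0 ut us -[s == t]eq_sym st.
rewrite big_split /= -big_distrr /= sumrB.
rewrite /bethe_value !big_cons /bethe_defect /= eqxx.
rewrite -[up u _ S]/(up u (bethe ts) S).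
rewrite -[in X in _ = _ + (X + _)]big_distrr /=.
set x := (u - t)^-1; ring.
Qed.
End Gaudin.

(** * Raising and lowering operators on subsets *)

Section Lefschetz.
Variables (C : numClosedFieldType) (I : finType).
Implicit Types (phi psi : {set I} -> C) (S K : {set I}).

Definition raise psi S : C := \sum_(i in S) psi (S :\ i).
Definition lower psi K : C := \sum_(i in ~: K) psi (i |: K).

(** Reindexing by S = [i |: K] with i outside K; this is what makes [raise] and [lower] adjoint. *)
Lemma sum_raise (G : {set I} -> {set I} -> C) :
  \sum_(S : {set I}) \sum_(i in S) G (S :\ i) S
  = \sum_(K : {set I}) \sum_(i in ~: K) G K (i |: K).
Proof.
rewrite (exchange_big_dep predT) //= [RHS](exchange_big_dep predT) //=.
apply: eq_bigr => i _.
rewrite (reindex_onto (fun K => i |: K) (fun S => S :\ i)) /=; last first.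
  by move=> S iS; rewrite setD1K.
apply: eq_big => [K|K]; rewrite ?inE.
  rewrite eqxx /=; apply/eqP/idP => [<-|iK]; first by rewrite !inE eqxx.
  by rewrite setU1K.
by case/andP=> _ /eqP->.
Qed.

(** The sl2 relation: adding i and removing j commute for i != j, so the two orders differ only in
    how many times they return to K. *)
Lemma lower_raise psi K :
  lower (raise psi) K
  = raise (lower psi) K + (#|~: K|%:R - #|K|%:R) * psi K.
Proof.
have e1 : lower (raise psi) K = #|~: K|%:R * psi K
    + \sum_(i in ~: K) \sum_(j in K) psi (i |: (K :\ j)).
  rewrite mulr_natl -sumr_const -big_split /=; apply: eq_bigr => i.
  rewrite inE => iK; rewrite /raise (big_setD1 i) ?setU11 //= setU1K //.
  congr (_ + _); apply: eq_bigr => j jK; congr psi; apply/setP=> k.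
  rewrite !inE; case: (eqVneq k i) => //= ->.
  by rewrite andbT; apply: contraNneq iK => ->.
have e2 : raise (lower psi) K = #|K|%:R * psi K
    + \sum_(j in K) \sum_(i in ~: K) psi (i |: (K :\ j)).
  rewrite mulr_natl -sumr_const -big_split /=; apply: eq_bigr => j jK.
  rewrite /lower (big_setD1 j) ?inE ?eqxx //= setD1K //; congr (_ + _).
  apply: eq_bigl => i; rewrite !inE negb_and negbK.
  by case: eqVneq => //= ->; rewrite jK.
by rewrite e1 e2 exchange_big /=; ring.
Qed.

Lemma norm_raise psi :
  \sum_(S : {set I}) `|raise psi S| ^+ 2
  = \sum_(K : {set I}) `|lower psi K| ^+ 2
    + \sum_(K : {set I}) (#|~: K|%:R - #|K|%:R) * `|psi K| ^+ 2.
Proof.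
transitivity (\sum_(K : {set I}) lower (raise psi) K * (psi K)^*).
  transitivity
    (\sum_(S : {set I}) \sum_(i in S) raise psi S * (psi (S :\ i))^*).
    by apply: eq_bigr => S _; rewrite normCK rmorph_sum big_distrr.
  rewrite (sum_raise (fun K S => raise psi S * (psi K)^*)).
  by apply: eq_bigr => K _; rewrite /lower big_distrl.
under eq_bigr do rewrite lower_raise mulrDl -mulrA -normCK.
rewrite big_split /=; congr (_ + _).
under eq_bigr do rewrite /raise big_distrl /=.
rewrite (sum_raise (fun K S => lower psi K * (psi S)^*)).
by apply: eq_bigr => K _; rewrite normCK rmorph_sum big_distrr.
Qed.

(* [raise] and [lower] are adjoint and generate sl2, whence injectivity of
   [raise] below the middle level. *)
Lemma raise_neq0 psi d K0 : (d.*2 < #|I|)%N ->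
    (forall K, psi K != 0 -> #|K| = d) -> psi K0 != 0 ->
  exists S, raise psi S != 0.
Proof.
move=> dI psid psi0; apply/existsP; apply: contraTT isT => /existsPn H.
have := norm_raise psi; rewrite big1 => [|S _]; last first.
  by have := H S; rewrite negbK => /eqP->; rewrite normr0 expr0n.
(* If [raise psi] vanished, this sum would be 0; but its cardinality factors are positive on the
   support of [psi]. *)
move=> e; have : 0 < \sum_(K : {set I}) `|lower psi K| ^+ 2
    + \sum_(K : {set I}) (#|~: K|%:R - #|K|%:R) * `|psi K| ^+ 2.
  apply: ltr_wpDl; first by apply: sumr_ge0 => K _; rewrite exprn_ge0.
  have cardK K : psi K != 0 -> 0 < #|~: K|%:R - #|K|%:R :> C.
    move/psid=> cK; rewrite subr_gt0 ltr_nat cK.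
    by move: dI; rewrite -(cardsC K) cK; lia.
  rewrite (bigD1 K0) //=; apply: ltr_pwDl.
    by rewrite mulr_gt0 ?cardK // exprn_gt0 // normr_gt0.
  apply: sumr_ge0 => K _; have [->|nz] := eqVneq (psi K) 0.
    by rewrite normr0 expr0n mulr0.
  by rewrite mulr_ge0 ?exprn_ge0 // ltW ?cardK.
by rewrite -e ltxx.
Qed.

End Lefschetz.

(** * Nonzero Bethe vectors and their real eigenvalues *)

Section BetheReality.
Variables (C : numClosedFieldType) (I : finType) (z : I -> C).
Implicit Types (phi : {set I} -> C) (S K : {set I}).

(* Rescaling phi by prod_(i in S) 1 / (t - z i) turns [up t] into [raise]. *)
Lemma up_neq0 t phi d K0 : off_poles z t -> (d.*2 < #|I|)%N ->
    (forall K, phi K != 0 -> #|K| = d) -> phi K0 != 0 ->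
  exists S, up z t phi S != 0.
Proof.
move=> ht dI phid phi0.
have pole0 i : pole z t i != 0 by rewrite invr_eq0 subr_eq0.
pose w S := \prod_(i in S) pole z t i.
have w0 S : w S != 0 by apply/prodf_neq0 => i _.
pose psi S := phi S / w S.
have [S Sn0] : exists S, raise psi S != 0.
  apply: (raise_neq0 (d := d) (K0 := K0)) => //.
    by move=> K; rewrite mulf_eq0 negb_or => /andP[/phid].
  by rewrite mulf_neq0 ?invr_eq0.
exists S; rewrite (_ : up _ _ _ _ = w S * raise psi S) ?mulf_neq0 //.
rewrite big_distrr; apply: eq_bigr => i iS; rewrite /psi /w (big_setD1 i) //=.
have := w0 (S :\ i); rewrite /w; set v := \prod_(_ in _) _ => v0.
by field.
Qed.

Lemma bethe_neq0 ts : {in ts, forall t, off_poles z t} ->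
  ((size ts).*2 <= #|I|)%N -> exists S, bethe z ts S != 0.
Proof.
move=> hts sz.
(* The induction must also carry the support of the vector, since [up_neq0] applies to a single
   level. *)
suff: [/\ forall K, bethe z ts K != 0 -> #|K| = size ts
  & exists S, bethe z ts S != 0] by case.
elim: ts hts sz => [|t ts IH] /= hts sz.
  split=> [K|]; last by exists set0; rewrite /vacuum eqxx oner_neq0.
  by rewrite /vacuum; have [->|_] := eqVneq K set0; rewrite ?cards0 ?eqxx.
have [||suppK [S0 S0n]] := IH.
- by move=> s sts; apply: hts; rewrite inE sts orbT.
- by apply: leq_trans sz; rewrite leq_double.
split; last first.
  apply: (up_neq0 (d := size ts)) S0n => //.
    by apply: hts; rewrite mem_head.
  by apply: leq_trans sz; rewrite ltn_double.
move=> K; rewrite /up; case: (pickP (mem K)) => [i0 _|K0]; last first.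
  by rewrite big_pred0 ?eqxx.
move=> nz; have [i iK ni] : exists2 i, i \in K & bethe z ts (K :\ i) != 0.
  apply/exists_inP; apply: contraNT nz => /exists_inPn H; apply/eqP.
  by apply: big1 => i /H; rewrite negbK => /eqP->; rewrite mulr0.
by rewrite (cardsD1 i) iK (suppK _ ni).
Qed.

Hypothesis z_real : forall i, z i \is Num.real.

(** The eigenvalue is a Rayleigh quotient. Its numerator is real because the coefficients are real
    and each transposition, acting as an involution on sets, is self-adjoint. *)
Lemma gaudin_eigenvalue_real u phi mu S0 : u \is Num.real ->
    (forall S, gaudin z u phi S = mu * phi S) -> phi S0 != 0 ->
  mu \is Num.real.
Proof.
move=> ureal eig nz.
pose N := \sum_(S : {set I}) `|phi S| ^+ 2.
have Npos : 0 < N.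
  rewrite /N (bigD1 S0) //=; apply: ltr_pwDl.
    by rewrite exprn_gt0 // normr_gt0.
  by apply: sumr_ge0 => S _; rewrite exprn_ge0.
have wreal i : (pole z u i)^* = pole z u i.
  by apply: CrealP; rewrite rpredV rpredB.
suff H : \sum_(S : {set I}) gaudin z u phi S * (phi S)^* \is Num.real.
  have E : mu * N = \sum_(S : {set I}) gaudin z u phi S * (phi S)^*.
    by rewrite big_distrr; apply: eq_bigr => S _; rewrite /= eig normCK mulrA.
  rewrite -(mulfK (lt0r_neq0 Npos) mu) E rpredM // rpredV.
  by rewrite realE ltW.
pose G i k := \sum_(S : {set I}) (phi (tperm i k @: S) - phi S) * (phi S)^*.
rewrite (_ : \sum_(S : {set I}) _
    = \sum_i \sum_k pole z u i * pole z u k * G i k).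
  apply/CrealP; rewrite rmorph_sum; apply: eq_bigr => i _.
  rewrite rmorph_sum; apply: eq_bigr => k _.
  rewrite !rmorphM /= !wreal; congr (_ * _).
  rewrite /G rmorph_sum /=.
  under eq_bigr do rewrite rmorphM rmorphB /= conjCK mulrBl.
  under [RHS]eq_bigr do rewrite mulrBl.
  rewrite !sumrB; congr (_ - _); last by apply: eq_bigr => S _; rewrite mulrC.
  have tK : involutive (fun S : {set I} => tperm i k @: S).
    move=> S; rewrite -imset_comp -[RHS]imset_id.
    by apply: eq_imset => j /=; rewrite tpermK.
  rewrite (reindex_inj (inv_inj tK)); apply: eq_bigr => S _.
  by rewrite tK mulrC.
under eq_bigr do rewrite /gaudin big_distrl /=.
rewrite exchange_big; apply: eq_bigr => i _ /=.
under eq_bigr do rewrite big_distrl /=.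
rewrite exchange_big; apply: eq_bigr => k _ /=.
by rewrite big_distrr; apply: eq_bigr => S _; rewrite /= mulrA.
Qed.

(** The Bethe equations remove the unwanted terms of [gaudin_bethe], leaving an eigenvector with
    eigenvalue twice [bethe_value]. *)
Lemma bethe_value_real (u : C) (ts : seq C) : u \is Num.real -> off_poles z u ->
    {in ts, forall t, off_poles z t} -> uniq (u :: ts) ->
    ((size ts).*2 <= #|I|)%N -> {in ts, forall t, bethe_defect z ts t = 0} ->
  bethe_value z u ts \is Num.real.
Proof.
move=> ureal hu hts uts sz eqs.
have [S0 nz] := bethe_neq0 hts sz.
have : 2 * bethe_value z u ts \is Num.real.
  apply: (gaudin_eigenvalue_real (u := u) (phi := bethe z ts)) nz => // S.
  rewrite gaudin_bethe // big1_seq ?addr0 // => s /andP[_ sts].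
  by rewrite eqs // mulr0 !mul0r.
have two0 : 2 != 0 :> C by rewrite pnatr_eq0.
move=> H; rewrite -[bethe_value _ _ _](mulKf two0).
by rewrite rpredM // rpredV rpred_nat.
Qed.
End BetheReality.

(** * Sums of reciprocal differences under inversion at a point *)

Section Inversion.
Variable C : fieldType.
Implicit Types (x t a : C) (s : seq C).

Definition invat a t : C := (t - a)^-1.

Lemma invat_inj a : injective (invat a).
Proof. by move=> x y /invr_inj /addIr. Qed.

Lemma invat_subV a t x : t != a -> x != a -> x != t ->
  (invat a t - invat a x)^-1 = (t - a) - (t - a) ^+ 2 * (t - x)^-1.
Proof.
move=> ta xa xt; rewrite /invat; field.
rewrite !subr_eq0 ta xa [t == x]eq_sym xt /=.
by rewrite (_ : _ + _ = x - t) ?subr_eq0 //; ring.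
Qed.

Lemma sum_invat a t s : t != a -> a \notin s -> t \notin s ->
  \sum_(x <- s) (invat a t - invat a x)^-1
  = (size s)%:R * (t - a) - (t - a) ^+ 2 * \sum_(x <- s) (t - x)^-1.
Proof.
move=> ta; elim: s => [|x s IH]; rewrite ?big_nil ?mul0r ?mulr0 ?subr0 //.
rewrite !inE !negb_or => /andP[ax As] /andP[tx ts].
rewrite !big_cons IH // invat_subV // 1?eq_sym // -natr1.
by ring.
Qed.

Lemma sum_invat_sqr a t s : t != a -> a \notin s -> t \notin s ->
  \sum_(x <- s) (invat a t - invat a x)^-1 ^+ 2
  = (size s)%:R * (t - a) ^+ 2
    - 2 * (t - a) ^+ 3 * \sum_(x <- s) (t - x)^-1
    + (t - a) ^+ 4 * \sum_(x <- s) (t - x)^-1 ^+ 2.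
Proof.
move=> ta; elim: s => [|x s IH].
  by rewrite !big_nil mul0r !mulr0 subr0 addr0.
rewrite !inE !negb_or => /andP[ax As] /andP[tx ts].
rewrite !big_cons IH // invat_subV // 1?eq_sym //.
by rewrite (_ : (size (x :: s))%:R = (size s)%:R + 1) ?natr1 //; ring.
Qed.

End Inversion.

(** * Reality of the logarithmic value, by sending a real root to infinity *)

Section RealValue.
Variable C : numClosedFieldType.
Implicit Types (x t a u : C) (zs ts rs : seq C).

Lemma real_invat a t : a \is Num.real -> t \is Num.real ->
  invat a t \is Num.real.
Proof. by move=> ar tr; rewrite rpredV rpredB. Qed.

(* (f'' / f - (W' / W) (f' / f)) (u), for f and W monic with roots rs and zs. *)
Definition log_value zs rs u : C :=
  (\sum_(t <- rs) (u - t)^-1) ^+ 2 - \sum_(t <- rs) (u - t)^-1 ^+ 2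
  - (\sum_(x <- zs) (u - x)^-1) * \sum_(t <- rs) (u - t)^-1.

(* The substitution x |-> 1 / (x - a) sends the root a of f to infinity; 0 is
   added to the images of the zs, with the multiplicity of infinity as a
   critical point. *)
Lemma log_value_real zs a ts u :
    {in zs, forall x, x \is Num.real} -> a \is Num.real -> u \is Num.real ->
    uniq (u :: a :: ts) -> {in u :: a :: ts, forall t, t \notin zs} ->
    (size zs <= (size ts).*2)%N ->
    {in ts, forall t, \sum_(x <- zs) (t - x)^-1
                      = \sum_(m <- rem t (a :: ts)) 2 / (t - m)} ->
  log_value zs (a :: ts) u \is Num.real.
Proof.
move=> zs_real a_real u_real uniq_uats out sz bethe_eq.
have /and3P[]: uniq (u :: a :: ts) by [].
rewrite inE negb_or => /andP[ua uts] ats uniq_ts.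
set d := size ts.
pose zl := map (invat a) zs ++ nseq (d.*2 - size zs) 0.
pose z i := tnth (in_tuple zl) i.
have size_zl : size zl = d.*2 by rewrite size_cat size_map size_nseq subnKC.
have sumE (F : C -> C) : \sum_i F (z i) = \sum_(x <- zl) F x.
  by rewrite [RHS]big_tnth.
have a_zs : a \notin zs by apply: out; rewrite !inE eqxx orbT.
have out' t : t \in u :: ts -> (t != a) * (t \notin zs).
  rewrite inE => tuts; split; last by apply: out; rewrite !inE orbCA tuts orbT.
  by case/predU1P: tuts => [->//|tts]; apply: contraNneq ats => <-.
have off t : t \in u :: ts -> off_poles z (invat a t).
  move=> tuts i; have [ta tzs] := out' t tuts.
  have : z i \in zl by apply: mem_tnth.
  rewrite mem_cat => /orP[/mapP[x xzs ->]|].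
    by rewrite (inj_eq (@invat_inj _ a)); apply: contraNneq tzs => ->.
  by rewrite mem_nseq => /andP[_ /eqP->]; rewrite invr_eq0 subr_eq0.
have totalE t : t \in u :: ts -> total z (invat a t)
    = d.*2%:R * (t - a) - (t - a) ^+ 2 * \sum_(x <- zs) (t - x)^-1.
  move=> tuts; have [ta tzs] := out' t tuts.
  rewrite /total (sumE (fun x => (invat a t - x)^-1)) big_cat big_map /=.
  have -> (F : C -> C) k : \sum_(x <- nseq k 0) F x = k%:R * F 0.
    by elim: k => [|k IH]; rewrite ?big_nil ?mul0r //= big_cons IH -natr1; ring.
  by rewrite sum_invat // subr0 /invat invrK natrB //; ring.
have shift_real : bethe_value z (invat a u) (map (invat a) ts) \is Num.real.
  apply: bethe_value_real.
  - move=> i; have : z i \in zl by apply: mem_tnth.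
    rewrite mem_cat => /orP[/mapP[x xzs ->]|].
      by rewrite real_invat // zs_real.
    by rewrite mem_nseq => /andP[_ /eqP->]; apply: rpred0.
  - exact: real_invat.
  - by apply: off; rewrite mem_head.
  - by move=> _ /mapP[t tts ->]; apply: off; rewrite inE tts orbT.
  - by rewrite -map_cons map_inj_uniq /= ?uts //; apply: invat_inj.
  - by rewrite size_map card_ord size_zl.
  move=> _ /mapP[t tts ->]; have tuts : t \in u :: ts by rewrite inE tts orbT.
  have [ta tzs] := out' t tuts.
  (* The term 2 / (t - a) of the original equation, times (t - a)^2, accounts for the gap between
     the 2 d points of [zl] and the d - 1 other roots, each counted twice. *)
  rewrite /bethe_defect totalE // bethe_eq //.
  rewrite rem_cons_neq // big_cons.
  have -> : rem (invat a t) (map (invat a) ts) = map (invat a) (rem t ts).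
    elim: (ts) => //= x s IH; rewrite (inj_eq (@invat_inj _ a)).
    by case: eqP => //= _; rewrite IH.
  rewrite big_map -!big_distrr /= sum_invat //; first last.
  - by rewrite mem_rem_uniq // !inE eqxx.
  - by apply: contra ats; apply: mem_rem.
  rewrite size_rem // -/d.
  have [k dk] : exists k, d = k.+1.
    by rewrite /d; case: (ts) tts => // x s _; exists (size s).
  rewrite dk /= -mul2n natrM -natr1.
  by field; rewrite subr_eq0.
have [_ u_zs] := out' u (mem_head _ _).
have A_real : \sum_(x <- zs) (u - x)^-1 \is Num.real.
  rewrite big_seq; apply: rpred_sum => x xzs; rewrite rpredV.
  by apply: rpredB => //; apply: zs_real.
have c0 : u - a != 0 by rewrite subr_eq0.
(* The correction terms involve only zs, a, u and the number d, hence are real; the possibly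
   non-real ts enter through [bethe_value] alone. *)
have -> : log_value zs (a :: ts) u = (u - a)^-1 ^+ 4 *
    (bethe_value z (invat a u) (map (invat a) ts)
     - (d.+1%:R * (u - a) ^+ 3 * (\sum_(x <- zs) (u - x)^-1)
        - d%:R * d.+1%:R * (u - a) ^+ 2)).
  rewrite /log_value /bethe_value totalE ?mem_head // !big_map.
  rewrite sum_invat // sum_invat_sqr // !big_cons -/d -mul2n natrM -natr1.
  by field.
have c_real : u - a \is Num.real by rewrite rpredB.
rewrite rpredM // ?rpredX ?rpredV //.
rewrite rpredB // rpredB // ?rpredM // ?rpredX // ?rpred_nat //.
Qed.
End RealValue.

(** * Derivatives of a product of linear factors *)

Section ProductDerivatives.
Variable C : fieldType.
Implicit Types (x t u : C) (rs : seq C).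

Definition root_poly rs : {poly C} := \prod_(t <- rs) ('X - t%:P).

Lemma horner_root_poly rs u : (root_poly rs).[u] = \prod_(t <- rs) (u - t).
Proof. by rewrite horner_prod; apply: eq_bigr => t _; rewrite !hornerE. Qed.

Lemma horner_root_poly_neq0 rs u : u \notin rs -> (root_poly rs).[u] != 0.
Proof. by move=> urs; rewrite -rootE root_prod_XsubC. Qed.

Lemma deriv_root_poly rs u : u \notin rs ->
  (root_poly rs)^`().[u] = (root_poly rs).[u] * \sum_(t <- rs) (u - t)^-1.
Proof.
rewrite /root_poly; elim: rs => [|t rs IH].
  by rewrite !big_nil derivC !hornerE.
rewrite inE negb_or => /andP[ut urs]; rewrite !big_cons derivM derivXsubC.
by rewrite !hornerE IH //; field; rewrite subr_eq0.
Qed.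

Lemma deriv2_root_poly rs u : u \notin rs ->
  (root_poly rs)^`()^`().[u] = (root_poly rs).[u]
    * ((\sum_(t <- rs) (u - t)^-1) ^+ 2 - \sum_(t <- rs) (u - t)^-1 ^+ 2).
Proof.
elim: rs => [|t rs IH].
  by rewrite /root_poly !big_nil !derivC horner0 expr2 mulr0 subrr mulr0.
rewrite inE negb_or => /andP[ut urs]; have := deriv_root_poly urs.
move: (IH urs); rewrite /root_poly !big_cons !derivM derivXsubC derivD !derivM.
rewrite derivXsubC derivC !hornerE => -> ->.
by rewrite /=; field; rewrite subr_eq0.
Qed.

Lemma root_poly_rem rs t : t \in rs ->
  root_poly rs = ('X - t%:P) * root_poly (rem t rs).
Proof.
by move=> trs; rewrite /root_poly (perm_big _ (perm_to_rem trs)) big_cons.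
Qed.

Lemma deriv_root_poly_root rs t : t \in rs ->
  (root_poly rs)^`().[t] = (root_poly (rem t rs)).[t].
Proof.
move=> trs; rewrite (root_poly_rem trs) derivM derivXsubC !hornerE subrr.
by rewrite mul0r addr0.
Qed.

(** Writing f = (X - t) g gives f'(t) = g(t) and f''(t) = 2 g'(t); this supplies the right-hand side
    of the Bethe equations. *)
Lemma deriv2_root_poly_root rs t : uniq rs -> t \in rs ->
  (root_poly rs)^`()^`().[t]
  = (root_poly rs)^`().[t] * \sum_(m <- rem t rs) 2 / (t - m).
Proof.
move=> urs trs; rewrite deriv_root_poly_root // (root_poly_rem trs).
rewrite !derivM derivXsubC derivD !derivM derivXsubC derivC !hornerE subrr.
rewrite deriv_root_poly ?mem_rem_uniq ?inE ?eqxx //.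
by rewrite -big_distrr /=; ring.
Qed.

End ProductDerivatives.

(** * Wronskians and the differential equation of a pencil *)

Section Wronskian.
Variable C : fieldType.
Implicit Types (f g h p q y : {poly C}).
Hypothesis char0 : forall n, n.+1%:R != 0 :> C.

Lemma deriv_eq0 p : p^`() = 0 -> (size p <= 1)%N.
Proof.
move=> p'0; rewrite leqNgt; apply/negP => sp.
have [k pk] : exists k, size p = k.+2.
  by case: (size p) sp => [|[|k]] // _; exists k.
have := congr1 (fun r : {poly C} => r`_k) p'0.
rewrite coef_deriv coef0 -mulr_natl => /eqP; rewrite mulf_eq0.
rewrite (negPf (char0 k)) /= => /eqP e.
have : lead_coef p != 0 by rewrite lead_coef_eq0 -size_poly_eq0 pk.
by rewrite lead_coefE pk e eqxx.
Qed.

Lemma dvdp_deriv_eq0 p : p %| p^`() -> p^`() = 0.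
Proof.
move=> dv; apply/eqP; apply: contraTT isT => nz.
have := dvdp_leq nz dv; rewrite leqNgt lt_size_deriv //.
by apply: contraNneq nz => ->; rewrite derivC.
Qed.

(** From p q' = p' q and coprimality, p divides p' and q divides q', which forces both derivatives
    to vanish. *)
Lemma wronskian_coprime_eq0 p q : coprimep p q -> wronskian p q = 0 ->
  (size p <= 1)%N /\ (size q <= 1)%N.
Proof.
move=> cop /eqP; rewrite subr_eq0 => /eqP e; split; apply: deriv_eq0.
  apply: dvdp_deriv_eq0; rewrite -(Gauss_dvdpl _ cop) -e.
  exact: dvdp_mulIl.
apply: dvdp_deriv_eq0; rewrite coprimep_sym in cop.
by rewrite -(Gauss_dvdpr _ cop) e dvdp_mulIr.
Qed.

(** Dividing by the gcd reduces to the coprime case, since a common factor d multiplies the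
    Wronskian by d^2. *)
Lemma wronskian_eq0 p q : p != 0 -> wronskian p q = 0 -> exists c, q = c *: p.
Proof.
move=> p0 W0.
have d0 : gcdp p q != 0 by rewrite gcdp_eq0 (negPf p0).
have pE := divpK (dvdp_gcdl p q); have qE := divpK (dvdp_gcdr p q).
set d := gcdp p q in d0 pE qE; set p1 := p %/ d in pE; set q1 := q %/ d in qE.
have cop : coprimep p1 q1 by apply: coprimep_div_gcd; rewrite p0.
have : wronskian p q = d ^+ 2 * wronskian p1 q1.
  by rewrite /wronskian -pE -qE !derivM; ring.
rewrite W0 => /esym/eqP; rewrite mulf_eq0 expf_eq0 (negPf d0) /= => /eqP.
case/(wronskian_coprime_eq0 cop) => /size1_polyC p1E /size1_polyC q1E.
have a0 : p1`_0 != 0.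
  by apply: contraNneq p0 => e; rewrite -pE p1E e mul0r.
exists (q1`_0 / p1`_0); rewrite -qE -[in RHS]pE {1}q1E.
by rewrite [in RHS]p1E coefC eqxx !mul_polyC scalerA divfK.
Qed.

Lemma wronskian_comb f g (a b c d : C) :
  wronskian (a *: f + b *: g) (c *: f + d *: g)
  = (a * d - b * c) *: wronskian f g.
Proof.
rewrite /wronskian !derivD !derivZ -!mul_polyC rmorphB !rmorphM /=.
by ring.
Qed.

Lemma deriv_wronskian f g :
  (wronskian f g)^`() = f * g^`()^`() - f^`()^`() * g.
Proof. by rewrite /wronskian derivB !derivM; ring. Qed.

Lemma wronskian_ode f h y : wronskian f h != 0 ->
    wronskian f h * y^`()^`() - (wronskian f h)^`() * y^`()
      + wronskian f^`() h^`() * y = 0 ->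
  exists a b, y = a *: f + b *: h.
Proof.
set W := wronskian f h => W0 ode.
have key g : W * g^`()^`() - W^`() * g^`() + wronskian f^`() h^`() * g = 0 ->
    exists c, wronskian g y = c *: W.
  move=> odeg; apply: wronskian_eq0 => //.
  rewrite {1}/wronskian deriv_wronskian {1}/wronskian.
  transitivity (g * (W * y^`()^`() - W^`() * y^`() + wronskian f^`() h^`() * y)
    - y * (W * g^`()^`() - W^`() * g^`() + wronskian f^`() h^`() * g)).
    by ring.
  by rewrite ode odeg !mulr0 subrr.
have [|c1 e1] := key f; first by rewrite /W deriv_wronskian /wronskian; ring.
have [|c2 e2] := key h; first by rewrite /W deriv_wronskian /wronskian; ring.
exists (- c2), c1; apply: (mulIf W0).
have -> : y * W = h * wronskian f y - f * wronskian h y.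
  by rewrite /W /wronskian; ring.
by rewrite e1 e2 -!mul_polyC rmorphN /=; ring.
Qed.

(** Subtracting a multiple of f from h leaves the Wronskian unchanged and lowers the degree of h
    below that of f. *)
Lemma size_wronskian f h N : size f = N.+2 -> (size h <= N.+2)%N ->
  (size (wronskian f h) <= N.*2.+1)%N.
Proof.
move=> sf sh.
have f0 : lead_coef f != 0 by rewrite lead_coef_eq0 -size_poly_eq0 sf.
pose g := h - (h`_N.+1 / lead_coef f) *: f.
have -> : wronskian f h = wronskian f g.
  by rewrite /g /wronskian derivB derivZ -!mul_polyC; ring.
have sg : (size g <= N.+1)%N.
  apply/leq_sizeP => j; rewrite leq_eqVlt coefB coefZ => /predU1P[<-|jN].
    by rewrite [f`_ _](_ : _ = lead_coef f) ?divfK ?subrr // lead_coefE sf.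
  have hj : h`_j = 0 by apply: nth_default; apply: leq_trans sh jN.
  by rewrite hj [f`_j]nth_default ?sf // mulr0 subrr.
have sd (p : {poly C}) m : (size p <= m.+1)%N -> (size p^`() <= m)%N.
  move=> sp; apply: leq_trans (size_poly _ _) _.
  by rewrite -subn1 leq_subLR add1n.
apply: leq_trans (size_polyD _ _) _; rewrite size_polyN geq_max.
apply/andP; split.
  apply: leq_trans (size_polyMleq _ _) _.
  by have := sd g N sg; rewrite sf -addnn; lia.
apply: leq_trans (size_polyMleq _ _) _.
have sf' : (size f^`() <= N.+1)%N by apply: sd; rewrite sf.
by have := leq_add sf' sg; rewrite addnS addSn addnn; case: (_ + _)%N.
Qed.
End Wronskian.

Lemma uniq_rem_notin (T : eqType) (s : seq T) :
  {in s, forall t, t \notin rem t s} -> uniq s.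
Proof.
elim: s => // x s IH H; rewrite cons_uniq.
have xs : x \notin s by have := H x (mem_head _ _); rewrite /= eqxx.
rewrite xs IH // => t ts; have := H t; rewrite inE ts orbT => /(_ isT).
by rewrite (rem_cons_neq ts xs) inE negb_or => /andP[].
Qed.

(** * A real basis of the pencil *)

Section RealPencil.
Variable C : numClosedFieldType.
Implicit Types (f h p q y : {poly C}) (a u x t : C) (zs ts rs : seq C).

Local Notation conjp := (map_poly (@Num.conj C)).

Lemma char0 n : n.+1%:R != 0 :> C.
Proof. by rewrite pnatr_eq0. Qed.

(** Natural numbers provide real points that avoid any finite set of roots. *)
Lemma poly_nat_neq0 p : p != 0 -> exists n : nat, p.[n%:R] != 0.
Proof.
move=> p0; pose r : seq C := map (GRing.natmul 1) (iota 0 (size p)).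
have : ~~ all (root p) r.
  apply/negP => H.
  have u : uniq r.
    by rewrite map_inj_uniq ?iota_uniq // => i j /eqP; rewrite eqr_nat => /eqP.
  by have := max_poly_roots p0 H u; rewrite size_map size_iota ltnn.
by rewrite -has_predC => /hasP[_ /mapP[n _ ->] H]; exists n.
Qed.

(** At real points outside s, p and its conjugate agree; the factor [root_poly s] makes the chosen
    point avoid s. *)
Lemma conj_poly_real p (s : seq C) :
  (forall u, u \is Num.real -> u \notin s -> p.[u] \is Num.real) -> conjp p = p.
Proof.
move=> H; apply/eqP; rewrite -subr_eq0; apply: contraT => nz.
have [|n] := @poly_nat_neq0 ((conjp p - p) * root_poly s).
  by rewrite mulf_neq0 // /root_poly monic_neq0 // monic_prod_XsubC.
rewrite hornerM mulf_eq0 negb_or -![_ == 0]rootE root_prod_XsubC.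
case/andP => + ns; rewrite rootE !hornerE subr_eq0; apply: contraNT => _.
rewrite -[X in (conjp p).[X]](rmorph_nat (@Num.conj C) n) horner_map.
by apply/eqP/CrealP; apply: H => //; apply: rpred_nat.
Qed.

Lemma conj_ode f h y :
    let W := wronskian f h in let Q := wronskian f^`() h^`() in
    conjp W = W -> conjp Q = Q ->
    W * y^`()^`() - W^`() * y^`() + Q * y = 0 ->
    W * (conjp y)^`()^`() - W^`() * (conjp y)^`() + Q * conjp y = 0.
Proof.
move=> W Q cW cQ /(congr1 conjp); rewrite rmorph0 rmorphD rmorphB !rmorphM /=.
by rewrite -!deriv_map cW cQ.
Qed.

(* The basis normalised by p(a) = 1, p'(a) = 0, q(a) = 0, q'(a) = 1 is unique,
   hence fixed by conjugation. *)
Lemma conj_fixed_basis f h a : a \is Num.real -> root f a ->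
    (wronskian f h).[a] != 0 ->
    conjp (wronskian f h) = wronskian f h ->
    conjp (wronskian f^`() h^`()) = wronskian f^`() h^`() ->
  exists x y z w : C, let p := x *: f + y *: h in let q := z *: f + w *: h in
    [/\ conjp p = p, conjp q = q & wronskian p q != 0].
Proof.
move=> a_real /rootP fa Wa cW cQ.
have W0 : wronskian f h != 0 by apply: contraNneq Wa => ->; rewrite horner0.
have Wa_eq : (wronskian f h).[a] = - (f^`().[a] * h.[a]).
  by rewrite /wronskian !hornerE fa; ring.
have /andP[f'a ha] : (f^`().[a] != 0) && (h.[a] != 0).
  by rewrite -negb_or -mulf_eq0 -oppr_eq0 -Wa_eq.
have conj_span y : (exists x z : C, y = x *: f + z *: h) ->
    exists x z, conjp y = x *: f + z *: h.
  case=> x [z ->]; apply: wronskian_ode => //; first exact: char0.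
  apply: conj_ode => //.
  by rewrite deriv_wronskian /wronskian !derivD !derivZ -!mul_polyC; ring.
(* As f(a) = 0, the value at a determines the coefficient of h, and the derivative at a then
   determines that of f. *)
have fixed y : (exists x z : C, y = x *: f + z *: h) ->
    y.[a] \is Num.real -> y^`().[a] \is Num.real -> conjp y = y.
  move=> yspan ya y'a; have [x [z e]] := conj_span y yspan.
  have [x' [z' e']] := yspan.
  have aE : a = Num.conj a by rewrite (CrealP a_real).
  have ev : (conjp y).[a] = y.[a].
    by rewrite [in LHS]aE horner_map; apply/CrealP.
  have ev' : (conjp y)^`().[a] = y^`().[a].
    by rewrite deriv_map [in LHS]aE horner_map; apply/CrealP.
  have ez : z = z'.
    by move: ev; rewrite e e' !hornerE fa !mulr0 !add0r => /(mulIf ha).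
  have ex : x = x'.
    move: ev'; rewrite e e' !derivD !derivZ !hornerE ez => /addIr.
    by move/(mulIf f'a).
  by rewrite e ex ez -e'.
exists (- h^`().[a] / (f^`().[a] * h.[a])), (h.[a])^-1, (f^`().[a])^-1, 0.
move=> p q.
have pa : p.[a] = 1 by rewrite /p !hornerE fa mulr0 add0r mulVf.
have p'a : p^`().[a] = 0.
  by rewrite /p !derivD !derivZ !hornerE; field; rewrite ha f'a.
have qa : q.[a] = 0 by rewrite /q !hornerE fa mulr0.
have q'a : q^`().[a] = 1.
  by rewrite /q !derivD !derivZ !hornerE; field.
split.
- apply: fixed; first by do 2!eexists.
    by rewrite pa rpred1.
  by rewrite p'a rpred0.
- apply: fixed; first by do 2!eexists.
    by rewrite qa rpred0.
  by rewrite q'a rpred1.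
apply: contraTneq isT => e; have := congr1 (horner^~ a) e.
rewrite /wronskian hornerD hornerN !hornerM pa p'a q'a.
rewrite mul0r mulr1 subr0 horner0 => /eqP.
by rewrite oner_eq0.
Qed.

(** At a root t of f, W = - f' h and W' = - f'' h. As W(t) != 0, the root is simple and W' / W = f''
    / f' there, which is its Bethe equation. *)
Lemma wronskian_derivs_real zs a ts h :
    {in zs, forall x, x \is Num.real} -> a \is Num.real ->
    {in a :: ts, forall t, t \notin zs} ->
    (size h <= (size ts).+2)%N ->
    wronskian (root_poly (a :: ts)) h = root_poly zs ->
  conjp (wronskian (root_poly (a :: ts))^`() h^`())
  = wronskian (root_poly (a :: ts))^`() h^`().
Proof.
set f := root_poly _; set W := root_poly zs.
move=> zs_real a_real out sh Wr.
have W't : W^`() = f * h^`()^`() - f^`()^`() * h by rewrite -Wr deriv_wronskian.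
have root_facts t : t \in a :: ts ->
    [/\ f.[t] = 0, f^`().[t] != 0 & h.[t] != 0].
  move=> tr; have ft : f.[t] = 0 by apply/rootP; rewrite root_prod_XsubC.
  have := horner_root_poly_neq0 (out t tr); rewrite -/W -Wr !hornerE ft mul0r.
  by rewrite sub0r oppr_eq0 mulf_eq0 negb_or => /andP[].
have uats : uniq (a :: ts).
  apply: uniq_rem_notin => t tr; have [_ + _] := root_facts t tr.
  by rewrite deriv_root_poly_root // -rootE root_prod_XsubC.
have sf : size f = (size ts).+2 by rewrite size_prod_XsubC.
(* The degree bound on W is exactly the inequality needed by [log_value_real]. *)
have sz : (size zs <= (size ts).*2)%N.
  by have := size_wronskian sf sh; rewrite Wr size_prod_XsubC.
apply: (@conj_poly_real _ (zs ++ a :: ts)) => u u_real.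
rewrite mem_cat negb_or => /andP[uzs uats'].
have fu := horner_root_poly_neq0 uats'; rewrite -/f in fu.
have -> : (wronskian f^`() h^`()).[u] = - (W.[u] * log_value zs (a :: ts) u).
  apply: (mulfI fu).
  have := deriv_root_poly uzs; have := deriv_root_poly uats'.
  have := deriv2_root_poly uats'; rewrite -/f -/W => e2 e1 eW.
  (* This is the differential equation satisfied by f, solved for f Q. *)
  rewrite -hornerM (_ : f * _ = W^`() * f^`() - W * f^`()^`()).
    by rewrite !hornerE e2 e1 eW /log_value; ring.
  by rewrite W't -Wr /wronskian; ring.
rewrite rpredN; apply: rpredM.
  rewrite horner_root_poly big_seq; apply: rpred_prod => x xzs.
  by apply: rpredB => //; apply: zs_real.
apply: log_value_real => //; first by rewrite cons_uniq uats' uats.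
- by move=> t; rewrite inE => /predU1P[->//|]; apply: out.
move=> t tts; have tr : t \in a :: ts by rewrite inE tts orbT.
have [ft f't ht] := root_facts t tr.
apply: (mulfI (horner_root_poly_neq0 (out t tr))).
rewrite -deriv_root_poly ?out //.
apply: (mulfI f't); rewrite -/W mulrCA -(deriv2_root_poly_root uats tr).
by rewrite -/f W't -Wr /wronskian !hornerE ft; ring.
Qed.

(** Taking the Wronskian of the combination with g or with f isolates x or y. *)
Lemma comb_neq0 f g (x y : C) : wronskian f g != 0 -> (x != 0) || (y != 0) ->
  x *: f + y *: g != 0.
Proof.
move=> W0 xy; apply: contraTneq xy => e; rewrite negb_or !negbK.
have W : wronskian (x *: f + y *: g) (0 *: f + 1 *: g) = x *: wronskian f g.
  by rewrite wronskian_comb; congr (_ *: _); ring.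
have W' : wronskian (1 *: f + 0 *: g) (x *: f + y *: g) = y *: wronskian f g.
  by rewrite wronskian_comb; congr (_ *: _); ring.
move: W W'; rewrite e /wronskian derivC !mul0r mulr0 subr0.
move=> /esym/eqP; rewrite scaler_eq0 (negPf W0) orbF => ->.
by rewrite mulr0 subr0 => /esym/eqP; rewrite scaler_eq0 (negPf W0) orbF.
Qed.

(** The pencil is given a new basis: a monic f of maximal degree with a real root a and no root in
    common with W, and h making the Wronskian monic. [wronskian_derivs_real] and [conj_fixed_basis]
    apply to it. *)
Lemma real_pencil f1 f2 : coprimep f1 f2 -> wronskian f1 f2 != 0 ->
    (forall x, root (wronskian f1 f2) x -> x \is Num.real) ->
  exists x y z w : C,
    let p := x *: f1 + y *: f2 in let q := z *: f1 + w *: f2 in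
    [/\ conjp p = p, conjp q = q & x * w - y * z != 0].
Proof.
move=> cop W0 Wreal.
have [zs Wzs] := closed_field_poly_normal (wronskian f1 f2).
set l := lead_coef _ in Wzs; rewrite -/(root_poly zs) in Wzs.
have l0 : l != 0 by rewrite lead_coef_eq0.
have zsP x : (x \in zs) = root (wronskian f1 f2) x.
  by rewrite Wzs rootZ // root_prod_XsubC.
pose M := (maxn (size f1) (size f2)).-1.
(* If a is not a root of B, then fa := f2(a) f1 - f1(a) f2 has maximal degree in
   the pencil and shares no root with the Wronskian; hence its roots are simple,
   and a is one of them. *)
pose B := wronskian f1 f2 * (f1`_M *: f2 + (- f2`_M) *: f1)
  * \prod_(x <- zs) (f1.[x] *: f2 + (- f2.[x]) *: f1).
have W20 : wronskian f2 f1 != 0.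
  by rewrite -oppr_eq0 /wronskian opprB mulrC [X in _ - X]mulrC.
have f10 : f1 != 0.
  by apply: contraNneq W0 => ->; rewrite /wronskian derivC !mul0r subrr.
have f20 : f2 != 0.
  by apply: contraNneq W0 => ->; rewrite /wronskian derivC !mulr0 subrr.
have B0 : B != 0.
  rewrite !mulf_neq0 //.
    apply: comb_neq0 => //; rewrite oppr_eq0 /M.
    by case: leqP => _; rewrite -lead_coefE lead_coef_eq0 ?f10 ?f20 ?orbT.
  rewrite prodf_seq_neq0; apply/allP => x _ /=; apply: comb_neq0 => //.
  rewrite oppr_eq0; have [//|/negPn/rootP/rootP f1x] := boolP (f1.[x] != 0).
  exact: coprimep_root cop f1x.
have [n] := poly_nat_neq0 B0; set a : C := n%:R.
have a_real : a \is Num.real by apply: rpred_nat.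
rewrite !hornerM horner_prod !mulf_eq0 !negb_or prodf_seq_neq0.
case/andP=> /andP[Wa lead0] /allP /= zsfa.
pose fa := f2.[a] *: f1 + (- f1.[a]) *: f2.
have faM : fa`_M != 0.
  by move: lead0; rewrite /fa !hornerE !coefE mulrC; congr (_ + _ != 0); ring.
have fa0 : fa != 0 by apply: contraNneq faM => ->; rewrite coef0.
have size_span (x y : C) : (size (x *: f1 + y *: f2)%R <= M.+1)%N.
  apply: leq_trans (size_polyD _ _) _; rewrite /M prednK; last first.
    by rewrite leq_max size_poly_gt0 f10.
  rewrite geq_max !(leq_trans (size_scale_leq _ _)) ?leq_maxl ?leq_maxr //.
have [rs fars] := closed_field_poly_normal fa; rewrite -/(root_poly rs) in fars.
set l' := lead_coef fa in fars.
have l'0 : l' != 0 by rewrite lead_coef_eq0.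
have ars : a \in rs.
  rewrite -root_prod_XsubC -(rootZ _ _ l'0) -fars rootE !hornerE.
  by apply/eqP; ring.
pose ts := rem a rs.
have rsE : root_poly rs = root_poly (a :: ts).
  by rewrite (root_poly_rem ars) /root_poly big_cons.
pose x := f2.[a] / l'; pose y := - f1.[a] / l'.
have fE : root_poly (a :: ts) = x *: f1 + y *: f2.
  apply: (scalerI l'0); rewrite -rsE -fars scalerDr !scalerA.
  by rewrite /x /y !mulrA ![l' * _]mulrC !mulfK.
have fM : size (root_poly (a :: ts)) = M.+1.
  apply/eqP; rewrite eqn_leq fE size_span /=.
  have -> : x *: f1 + y *: f2 = l'^-1 *: fa.
    by rewrite -fE -rsE fars scalerA mulVf ?scale1r.
  by rewrite size_scale ?invr_eq0 // ltnNge; apply: contra faM => /leq_sizeP->.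
(* The determinant 1 / l of the change of basis cancels the leading coefficient of the Wronskian. *)
have [z [w xywz]] : exists z w, x * w - y * z = l^-1.
  have [x0|x0] := eqVneq x 0.
    have y0 : y != 0.
      apply: contra_eqN fM => /eqP y0.
      by rewrite fE x0 y0 !scale0r addr0 size_poly0.
    by exists (- (l^-1 / y)), 0; rewrite x0; field; rewrite l0.
  by exists 0, (l^-1 / x); field; rewrite l0 x0.
pose h := z *: f1 + w *: f2.
have Wfh : wronskian (root_poly (a :: ts)) h = root_poly zs.
  by rewrite fE /h wronskian_comb xywz Wzs scalerA mulVf ?scale1r.
have zs_real : {in zs, forall x, x \is Num.real}.
  by move=> t; rewrite zsP; apply: Wreal.
have out : {in a :: ts, forall t, t \notin zs}.
  move=> t trs; apply/negP => tzs; have /eqP := zsfa t tzs; apply.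
  have : root (root_poly (a :: ts)) t by rewrite root_prod_XsubC.
  rewrite -rsE -(rootZ _ _ l'0) -fars => /rootP.
  by rewrite !hornerE => e; rewrite -[RHS]e; ring.
have Qreal := wronskian_derivs_real zs_real a_real out _ Wfh.
have [||||x' [y' [z' [w' [cp cq Wpq]]]]] :=
  @conj_fixed_basis (root_poly (a :: ts)) h a a_real.
- by rewrite root_prod_XsubC mem_head.
- by rewrite Wfh horner_root_poly_neq0 // out // mem_head.
- rewrite Wfh; apply: (@conj_poly_real _ [::]) => u u_real _.
  rewrite horner_root_poly big_seq; apply: rpred_prod => t tzs.
  by apply: rpredB => //; apply: zs_real.
- apply: Qreal; have := size_span z w; rewrite -fM size_prod_XsubC; apply.
(* Entries of the product of the two changes of basis. *)
exists (x' * x + y' * z), (x' * y + y' * w).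
exists (z' * x + w' * z), (z' * y + w' * w).
have combE (r s : C) : (r * x + s * z) *: f1 + (r * y + s * w) *: f2
    = r *: root_poly (a :: ts) + s *: h.
  by rewrite fE /h !scalerDr !scalerA !scalerDl addrACA.
rewrite /= !combE; split => //.
apply: contraNneq Wpq => e.
by rewrite -!combE wronskian_comb e scale0r.
Qed.
End RealPencil.

(** * Fractions in lowest terms and descent to real coefficients *)

Lemma frac_tofrac (A : idomainType) (g : {fraction A}) :
  exists2 d, d != 0 & exists n, g = FracField.tofrac n / FracField.tofrac d.
Proof.
elim/quotW: g => r; have d0 := denom_ratioP r.
exists \d_r => //; exists \n_r.
apply: (canRL (mulfK _)); first by rewrite tofrac_eq0.
unlock FracField.tofrac; rewrite !piE; apply/eqmodP.
rewrite /= FracField.equivfE /FracField.mulf.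
by rewrite !numden_Ratio ?mulr1 ?mulf_neq0 ?oner_neq0 // mulrC.
Qed.

Lemma frac_coprime (K : fieldType) (g : ratfun K) : exists f1 f2,
  [/\ f2 != 0, coprimep f1 f2 & g = tofrac f1 / tofrac f2].
Proof.
have [d d0 [n ->]] := frac_tofrac g.
have e0 : gcdp n d != 0 by rewrite gcdp_eq0 (negPf d0) andbF.
have nE := divpK (dvdp_gcdl n d); have dE := divpK (dvdp_gcdr n d).
exists (n %/ gcdp n d), (d %/ gcdp n d); split.
- by apply: contraNneq d0 => e; rewrite -dE e mul0r.
- by apply: coprimep_div_gcd; rewrite d0 orbT.
set n1 := n %/ _ in nE *; set d1 := d %/ _ in dE *.
have ->: tofrac n / tofrac d = tofrac (n1 * gcdp n d) / tofrac (d1 * gcdp n d).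
  by rewrite nE dE.
by rewrite !tofracM -mulf_div divff ?mulr1 // tofrac_eq0.
Qed.

(** If the Wronskian vanished, coprimality would make both polynomials constant, and so their
    quotient. *)
Lemma wronskian_frac_neq0 (K : fieldType) (f1 f2 : {poly K}) :
    (forall n, n.+1%:R != 0 :> K) -> f2 != 0 -> coprimep f1 f2 ->
    nonconstant (tofrac f1 / tofrac f2) ->
  wronskian f1 f2 != 0.
Proof.
move=> char0 f20 cop nc; apply/eqP => /(wronskian_coprime_eq0 char0 cop) [].
move=> /size1_polyC f1E /size1_polyC f2E; apply: (nc (f1`_0 / f2`_0)).
have c0 : f2`_0 != 0 by apply: contraNneq f20 => e; rewrite f2E e.
apply: (canLR (mulfK _)); first by rewrite tofrac_eq0.
by rewrite /cst_ratfun -tofracM {2}f2E -polyCM divfK // -f1E.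
Qed.

Lemma conj_fixed_real (R : realType) (p : {poly R[i]}) :
  map_poly (@Num.conj R[i]) p = p ->
  p = map_poly (real_complex R) (map_poly (@complex.Re R) p).
Proof.
move=> cp; apply/polyP => k; rewrite !coef_map_id0 //.
have /CrealP/RRe_real -> // : (p`_k)^* = p`_k.
by rewrite -[RHS](congr1 (fun r : {poly _} => r`_k) cp) coef_map.
Qed.

Theorem theorem1 (R : realType) (g : ratfun R[i])
    (g_nonconst : nonconstant g)
    (g_crit_real : forall z : R[i], critical_point g z -> z \is Num.real) :
  exists h : ratfun R[i], real_ratfun h /\ ratfun_equiv h g.
Proof.
have [f1 [f2 [f20 cop gE]]] := frac_coprime g.
have W0 : wronskian f1 f2 != 0.
  apply: wronskian_frac_neq0 => //; last by rewrite -gE.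
  exact: char0.
have [|x [y [z [w [cp cq det]]]]] := real_pencil cop W0.
  by move=> t Wt; apply: g_crit_real; exists f1, f2.
set p := x *: f1 + y *: f2 in cp; set q := z *: f1 + w *: f2 in cq.
have q0 : q != 0.
  apply: comb_neq0 => //; apply: contraNT det.
  by rewrite negb_or !negbK => /andP[/eqP-> /eqP->]; rewrite !mulr0 subrr.
have combE (r s : R[i]) : cst_ratfun r * g + cst_ratfun s
    = tofrac (r *: f1 + s *: f2) / tofrac f2.
  rewrite gE /cst_ratfun tofracD -!mul_polyC !tofracM mulrDl.
  by rewrite mulfK ?tofrac_eq0 // mulrA.
exists (tofrac p / tofrac q); split.
  exists (map_poly (@complex.Re R) p), (map_poly (@complex.Re R) q).
  rewrite -!conj_fixed_real //; split=> //.
  by apply: contraNneq q0 => e; rewrite (conj_fixed_real cq) e rmorph0.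
exists x, y, z, w; split=> //.
  by rewrite combE mulf_neq0 ?invr_eq0 ?tofrac_eq0.
by rewrite /mobius_comp !combE -/p -/q invf_div mulrA divfK ?tofrac_eq0.
Qed.
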